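(* Let $p_0\in(0,1)$, $\bar\alpha\in(0,1]$, and consider the one-sided all-accept verification cascade with prior $p_0$ and latent false-accept distribution $G=\delta_{\bar\alpha}$ (as described in the context). Then for every integer $k\ge0$, $m_k:=\mathbb{E}_{\alpha\sim G}[\alpha^k]=\bar\alpha^{\,k}$ and $$\ell_k=\ell_0+k\ln\Lambda,\qquad \Lambda=1/\bar\alpha.$$
   Context: One-sided all-accept cascade: a candidate answer has a random truth label $C\in\{0,1\}$ with $\mathbb{P}(C=1)=p_0$. It is passed through $k$ gates, each returning accept or reject. Given $C=1$, every gate accepts with probability $1$. Given $C=0$, a latent variable $\alpha$ is drawn from $G$, and conditionally on $\alpha$ (and $C=0$) the $k$ verdicts are i.i.d., each being accept with probability $\alpha$. Define $r_k=\mathbb{P}(C=1\mid\text{all }k\text{ gates accept})$ and $\ell_k=\ln\frac{r_k}{1-r_k}$; in particular $\ell_0=\ln\frac{p_0}{1-p_0}$. *)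

(* Defs.v *)
From HB Require Import structures.
From mathcomp Require Import all_boot all_order all_algebra.
From mathcomp Require Import all_classical all_reals all_analysis.

Set Implicit Arguments.
Unset Strict Implicit.
Unset Printing Implicit Defensive.

Import Order.TTheory GRing.Theory Num.Theory.
Import numFieldNormedType.Exports.

Local Open Scope classical_set_scope.
Local Open Scope ring_scope.

(* P(A | B); equals the junk value 0 when P(B) = 0. *)
Definition cond_prob (d : measure_display) (T : measurableType d)
    (R : realType) (P : probability T R) (A B : set T) : R :=
  fine (P (A `&` B)) / fine (P B).

(* The one-sided cascade with n gates: C is the truth label, alpha the latent
   false-accept rate, V i the verdict of gate i (true = accept).  Nothing is
   assumed about alpha on {C = 1}. *)
Record one_sided_cascade (d : measure_display) (T : measurableType d)
    (R : realType) (P : probability T R) (p0 : R)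
    (G : probability (measurableTypeR R) R) (n : nat)
    (C : {RV P >-> bool}) (alpha : {RV P >-> measurableTypeR R})
    (V : 'I_n -> {RV P >-> bool}) : Prop := OneSidedCascade {
  cascade_prior : P (C @^-1` [set true]) = p0%:E ;
  cascade_true : forall i : 'I_n,
    cond_prob P (V i @^-1` [set true]) (C @^-1` [set true]) = 1 ;
  cascade_latent_unit : G `[0, 1]%classic = 1%E ;
  cascade_latent : forall B : set (measurableTypeR R), measurable B ->
    (cond_prob P (alpha @^-1` B) (C @^-1` [set false]))%:E = G B ;
  (* Defining property of the conditional probability given alpha on {C = 0}:
     P(V = v | alpha, C = 0) = \prod_i Bernoulli(alpha)(v i) for every vector v
     of verdicts, i.e. given alpha and C = 0 the verdicts are i.i.d.
     Bernoulli(alpha). *)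
  cascade_false : forall (v : 'I_n -> bool) (B : set (measurableTypeR R)),
    measurable B ->
    P ((C @^-1` [set false] `&` alpha @^-1` B)
         `&` [set w | forall i : 'I_n, V i w = v i]) =
    (\int[P]_(w in C @^-1` [set false] `&` alpha @^-1` B)
       (\prod_(i < n) bernoulli_pmf (alpha w : R) (v i))%:E)%E
}.

Definition all_accept (T : Type) (n : nat) (V : 'I_n -> T -> bool) (k : nat) :
    set T :=
  [set w | forall i : 'I_n, (i < k)%N -> V i w = true].

Definition posterior (d : measure_display) (T : measurableType d)
    (R : realType) (P : probability T R) (C : T -> bool)
    (n : nat) (V : 'I_n -> T -> bool) (k : nat) : R :=
  cond_prob P (C @^-1` [set true]) (all_accept V k).

Definition posterior_logit (d : measure_display) (T : measurableType d)
    (R : realType) (P : probability T R) (C : T -> bool)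
    (n : nat) (V : 'I_n -> T -> bool) (k : nat) : R :=
  ln (posterior P C V k / (1 - posterior P C V k)).

Definition latent_moment (R : realType)
    (G : probability (measurableTypeR R) R) (k : nat) : \bar R :=
  'E_G[(fun a : R => a ^+ k)].

(* Main.v *)
Require Import Defs.
From HB Require Import structures.
From mathcomp Require Import all_boot all_order all_algebra.
From mathcomp Require Import all_classical all_reals all_analysis.

Import Order.TTheory GRing.Theory Num.Theory.
Import numFieldNormedType.Exports.

Local Open Scope classical_set_scope.
Local Open Scope ring_scope.

(** On [C = 1] all gates accept almost surely, so the event "[C = 1] and the
first [k] gates accept" has probability [p0].  On [C = 0] the latent variable
equals [abar] almost surely; summing the joint law of the [n] verdicts over the
vectors accepting at the first [k] gates gives probability
[(1 - p0) * abar ^+ k].  Hence the posterior odds are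
[p0 / ((1 - p0) * abar ^+ k)]. *)

Lemma cond_prob_eq1 (d : measure_display) (T : measurableType d)
    (R : realType) (P : probability T R) (A B : set T) :
  measurable A -> measurable B -> cond_prob P A B = 1 -> P (A `&` B) = P B.
Proof.
move=> mA mB; rewrite /cond_prob => PAB.
(* Division by zero yields 0, so a conditional probability equal to 1 already forces [P B] to be
   nonzero. *)
have PB0 : fine (P B) != 0.
  by apply/eqP => PB0; move/eqP: PAB; rewrite PB0 invr0 mulr0 eq_sym oner_eq0.
have := congr1 (fun x => x * fine (P B)) PAB; rewrite mul1r divfK// => PABB.
rewrite -(fineK (fin_num_measure P (A `&` B) _)); last exact: measurableI.
by rewrite PABB fineK// fin_num_measure.
Qed.

Lemma cond_prob_eq1_setD (d : measure_display) (T : measurableType d)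
    (R : realType) (P : probability T R) (A B : set T) :
  measurable A -> measurable B -> cond_prob P A B = 1 -> P (B `\` A) = 0%E.
Proof.
move=> mA mB PAB.
have -> : P (B `\` A) = (P B - P (B `&` A))%E.
  by apply: measureD => //; rewrite ltey_eq fin_num_measure.
by rewrite [B `&` A]setIC cond_prob_eq1// subee// fin_num_measure.
Qed.

(** An almost sure property [A] of the points of [B] may be inserted into any event inside [B]. This
    serves twice: to add one more accepting gate on [[C = 1]], and to pin [alpha] to [abar] on
    [[C = 0]]. *)
Lemma measure_setI_setD0 (d : measure_display) (T : measurableType d)
    (R : realType) (mu : {measure set T -> \bar R}) (A B E : set T) :
  measurable A -> measurable B -> measurable E -> mu (B `\` A) = 0%E ->
  mu (B `&` E) = mu (B `&` A `&` E).
Proof.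
move=> mA mB mE BA0.
have BEA0 : mu (B `&` E `\` A) = 0%E.
  apply: (subset_measure0 (B := B `\` A)) => //.
  - by apply: measurableD => //; exact: measurableI.
  - exact: measurableD.
  - by move=> x [[Bx _] nAx].
rewrite (measureDI mu (measurableI _ _ mB mE) mA) setIAC -[RHS]add0e.
by congr (_ + _)%E; exact: BEA0.
Qed.

Lemma measurable_RV_bool (d : measure_display) (T : measurableType d)
    (R : realType) (P : probability T R) (X : {RV P >-> bool}) (b : bool) :
  measurable (X @^-1` [set b]).
Proof. exact: measurable_funPTI. Qed.

Section all_accept_events.
Context {d : measure_display} {T : measurableType d} {R : realType}.
Variables (P : probability T R) (n : nat) (V : 'I_n -> {RV P >-> bool}).

Lemma measurable_all_accept (k : nat) :
  measurable (all_accept (fun i => V i : T -> bool) k).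
Proof.
rewrite (_ : all_accept _ _ =
    \bigcap_(i in [set i : 'I_n | (i < k)%N]) (V i @^-1` [set true])).
  by apply: fin_bigcap_measurable => // i _; exact: measurable_RV_bool.
by apply/seteqP; split => w h i; exact: h.
Qed.

Lemma measurable_verdicts (v : 'I_n -> bool) :
  measurable [set w | forall i : 'I_n, V i w = v i].
Proof.
rewrite (_ : mkset _ = \bigcap_(i in [set: 'I_n]) (V i @^-1` [set v i])).
  by apply: fin_bigcap_measurable => // i _; exact: measurable_RV_bool.
by apply/seteqP; split => w h i; [move=> _|]; exact: h.
Qed.

Lemma all_accept0 : all_accept (fun i => V i : T -> bool) 0 = setT.
Proof. by apply/seteqP; split. Qed.

Lemma all_acceptS (k : nat) (kn : (k < n)%N) :
  all_accept (fun i => V i : T -> bool) k.+1 =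
  V (Ordinal kn) @^-1` [set true] `&` all_accept (fun i => V i : T -> bool) k.
Proof.
apply/seteqP; split => [w h|w [hk h] i].
  by split => [|i ik]; apply: h => //=; rewrite ltnS ltnW.
rewrite ltnS leq_eqVlt => /orP[/eqP ik|]; last exact: h.
by rewrite (_ : i = Ordinal kn)//; exact: val_inj.
Qed.

(** The cascade prescribes the law of complete verdict vectors only, so the event is cut into one
    piece per vector in [{0,1}^n] that accepts at the first [k] gates and is free at the others. *)
Lemma all_accept_bigcup (k : nat) :
  all_accept (fun i => V i : T -> bool) k =
  \bigcup_(v in [set` family (fun i : 'I_n =>
      [pred b : bool | (i < k)%N ==> b])])
    [set w | forall i : 'I_n, V i w = v i].
Proof.
apply/seteqP; split => [w h|w [v /familyP vk hv] i ik].
  exists [ffun i => V i w] => /=; last by move=> i; rewrite ffunE.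
  by apply/familyP => i; rewrite ffunE inE; apply/implyP => /h.
by rewrite hv; have := vk i; rewrite inE ik.
Qed.

End all_accept_events.

Lemma prod_ord_ltn_const (R : comPzRingType) (a : R) (n k : nat) :
  (k <= n)%N -> \prod_(i < n) (if (i < k)%N then a else 1) = a ^+ k.
Proof.
move=> kn; rewrite -big_mkcond/= -(big_ord_widen _ (fun=> a) kn).
by rewrite prodr_const card_ord.
Qed.

(** By distributivity the sum of products is a product over gates of sums over the admissible
    verdicts. A gate [i < k] contributes [a]; any other gate contributes [a + (1 - a) = 1]. *)
Lemma sum_bernoulli_all_accept (R : realType) (a : R) (n k : nat) :
  (k <= n)%N ->
  \sum_(v in family (fun i : 'I_n => [pred b : bool | (i < k)%N ==> b]))
    \prod_(i < n) bernoulli_pmf a (v i) = a ^+ k.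
Proof.
move=> kn; rewrite -(bigA_distr_big_dep _ (fun _ b => bernoulli_pmf a b)).
rewrite -(prod_ord_ltn_const _ a _ _ kn); apply: eq_bigr => i _.
rewrite big_mkcond big_bool/= /bernoulli_pmf implybT implybF.
by case: (i < k)%N; rewrite /= ?addr0 ?subrKC.
Qed.

Section cascade.
Context {R : realType} {d : measure_display} {T : measurableType d}.
Variables (P : probability T R) (p0 abar : R) (n : nat).
Variables (C : {RV P >-> bool}) (alpha : {RV P >-> measurableTypeR R}).
Variable V : 'I_n -> {RV P >-> bool}.
Hypothesis hC :
  one_sided_cascade p0 (dirac (abar : measurableTypeR R)) C alpha V.

Let Ct := C @^-1` [set true].
Let Cf := C @^-1` [set false].
Let A k := all_accept (fun i => V i : T -> bool) k.

Let CfE : Cf = ~` Ct.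
Proof. by apply/seteqP; split => w; rewrite /Cf /Ct /=; case: (C w). Qed.

Lemma cascade_prior_false : P Cf = (1 - p0)%:E.
Proof.
by rewrite CfE probability_setC ?(cascade_prior hC)//; exact: measurable_RV_bool.
Qed.

(** Induction on [k]: gate [k] accepts almost surely on [[C = 1]], so requiring its acceptance
    removes only a null set. *)
Lemma cascade_true_all_accept (k : nat) : (k <= n)%N ->
  P (Ct `&` A k) = p0%:E.
Proof.
elim: k => [_|k IH kn]; first by rewrite /A all_accept0 setIT (cascade_prior hC).
rewrite /A (all_acceptS _ _ _ _ kn) setIA -(IH (ltnW kn)); apply/esym.
apply: measure_setI_setD0.
- exact: measurable_RV_bool.
- exact: measurable_RV_bool.
- exact: measurable_all_accept.
- apply: cond_prob_eq1_setD; [exact: measurable_RV_bool..|].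
  exact: (cascade_true hC).
Qed.

Lemma cascade_false_all_accept (k : nat) : (k <= n)%N ->
  P (Cf `&` A k) = ((1 - p0) * abar ^+ k)%:E.
Proof.
move=> kn.
(* The singleton carries the whole Dirac mass, and on its preimage the integrand of [cascade_false]
   is constant. *)
pose B : set (measurableTypeR R) := [set abar].
have mB : measurable B by exact: measurable_set1.
have mCf : measurable Cf by exact: measurable_RV_bool.
have maB : measurable (alpha @^-1` B) by exact: measurable_funPTI.
have mD : measurable (Cf `&` alpha @^-1` B) by exact: measurableI.
have D0 : P (Cf `\` alpha @^-1` B) = 0%E.
  apply: cond_prob_eq1_setD => //; apply: EFin_inj.
  by rewrite (cascade_latent hC)//= diracE mem_set.
have PD : P (Cf `&` alpha @^-1` B) = (1 - p0)%:E.
  rewrite -cascade_prior_false -[Cf in RHS]setIT -[X in P X]setIT; apply/esym.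
  exact: measure_setI_setD0.
have -> : P (Cf `&` A k) = P (Cf `&` alpha @^-1` B `&` A k).
  by apply: measure_setI_setD0 => //; exact: measurable_all_accept.
rewrite /A all_accept_bigcup setI_bigcupr measure_fin_bigcup//; last 2 first.
(* The pieces are disjoint: an outcome [w] determines its verdict vector. *)
- move=> u v _ _ [w [[_ uw] [_ vw]]].
  by apply/ffunP => i; rewrite -uw -vw.
- by move=> v _; apply: measurableI => //; exact: measurable_verdicts.
rewrite -(sum_bernoulli_all_accept _ abar _ _ kn) mulr_sumr -sumEFin.
rewrite fsbig_finite//=.
(* The finitely supported sum enumerates the same vectors in another order; this aligns it with the
   sum over the family. *)
rewrite (perm_big (enum (family (fun i : 'I_n =>
  [pred b : bool | (i < k)%N ==> b]))))/=; last first.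
  apply: uniq_perm; rewrite ?enum_uniq ?finmap.fset_uniq// => v.
  by rewrite in_fset_set// mem_enum; apply/idP/idP => [|h]; rewrite inE.
rewrite big_enum/=; apply: eq_bigr => v _.
rewrite (cascade_false hC)//.
(* Since [alpha w = abar] throughout the domain, the integral is this constant times the mass
   [1 - p0] of the domain. *)
rewrite (eq_integral (cst (\prod_(i < n) bernoulli_pmf abar (v i))%:E)).
  rewrite integral_cst// mulrC EFinM; congr (_ * _)%E; exact: PD.
by move=> w; rewrite inE => -[_ /= ->].
Qed.

Lemma cascade_posterior_logit (k : nat) :
  0 < p0 < 1 -> 0 < abar -> (k <= n)%N ->
  posterior_logit P C (fun i => V i : T -> bool) k =
    ln (p0 / (1 - p0)) - k%:R * ln abar.
Proof.
move=> /andP[p00 p01] a0 kn.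
have q0 : 0 < 1 - p0 by rewrite subr_gt0.
have ak0 : 0 < abar ^+ k by exact: exprn_gt0.
have qa0 : 0 < (1 - p0) * abar ^+ k by exact: mulr_gt0.
(* Law of total probability over the two values of [C]. *)
have PA : P (A k) = (p0 + (1 - p0) * abar ^+ k)%:E.
  have -> : P (A k) = (P (A k `\` Ct) + P (A k `&` Ct))%E.
    by apply: measureDI; [exact: measurable_all_accept|exact: measurable_RV_bool].
  rewrite setDE -CfE setIC cascade_false_all_accept// setIC.
  by rewrite cascade_true_all_accept// -EFinD addrC.
rewrite /posterior_logit /posterior /cond_prob cascade_true_all_accept// PA/=.
set s := p0 + _.
have s0 : s != 0 by rewrite gt_eqF// addr_gt0.
have -> : p0 / s / (1 - p0 / s) = p0 / (1 - p0) / abar ^+ k.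
  (* Writing 1 as [s / s] gives [1 - p0 / s = (s - p0) / s], and the normalising factor [s] cancels
     from the odds. *)
  rewrite -[X in X - _](divff s0) -mulrBl invfM invrK.
  rewrite (_ : s - p0 = (1 - p0) * abar ^+ k); last by rewrite /s addrAC subrr add0r.
  by rewrite invfM mulrACA [s^-1 * s]mulVf// mulr1 mulrA.
by rewrite ln_div ?posrE ?divr_gt0// lnXn// mulr_natl.
Qed.

End cascade.

Lemma latent_moment_dirac (R : realType) (a : R) (k : nat) :
  latent_moment (dirac (a : measurableTypeR R)) k = (a ^+ k)%:E.
Proof.
rewrite /latent_moment unlock integral_dirac//.
  by rewrite diracE mem_set// mul1e.
by apply/measurable_realfun.measurable_EFinP; exact: measurable_realfun.measurable_funX.
Qed.

Theorem corollary3p2 (R : realType) (p0 abar : R)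
    (hp0 : 0 < p0 < 1) (habar : 0 < abar <= 1)
    (d : measure_display) (T : measurableType d) (P : probability T R)
    (n : nat) (C : {RV P >-> bool}) (alpha : {RV P >-> measurableTypeR R})
    (V : 'I_n -> {RV P >-> bool})
    (hcascade : one_sided_cascade p0 (dirac (abar : measurableTypeR R)) C alpha V)
    (k : nat) (hk : (k <= n)%N) :
  let Lambda := 1 / abar in
  latent_moment (dirac (abar : measurableTypeR R)) k = (abar ^+ k)%:E /\
  posterior_logit P C (fun i => V i : T -> bool) k =
    posterior_logit P C (fun i => V i : T -> bool) 0 + k%:R * ln Lambda.
Proof.
move=> Lambda; have /andP[a0 _] := habar.
split; first exact: latent_moment_dirac.
(* The closed form is used at both [k] and 0; at 0 it reduces to the prior log-odds. *)
rewrite !(cascade_posterior_logit _ _ _ _ _ _ _ hcascade)//.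
by rewrite mul0r subr0 /Lambda div1r lnV ?posrE// mulrN.
Qed.
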